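(* In the setting of the context, let the real system be controlled by $u=\overline u+\kappa(e,\overline e,v,\overline v)$. The state feedback law designed as $$\kappa(e,\overline e,v,\overline v)=-k(e-\overline e)-k(v-\overline v),$$ where $k>0$ is chosen such that $$k>\frac1{\underline J}\Big[(1+2\rho)L+\frac54\Big],\qquad \rho>\frac L2,$$ renders the sets $$\Omega_1:=\Big\{\widetilde e(t)\in\mathbb{R}^n:\ \|\widetilde e(t)\|_2\le\tfrac{\widetilde d}{\sqrt{\min\{\alpha_1,\alpha_2\}}},\ \forall t\ge0\Big\},$$ $$\Omega_2:=\Big\{\widetilde v(t)\in\mathbb{R}^n:\ \|\widetilde v(t)\|_2\le\tfrac{2\widetilde d}{\sqrt{\min\{\alpha_1,\alpha_2\}}},\ \forall t\ge0\Big\}$$ Robust Control Invariant (RCI) sets (as defined in the context) for the deviation dynamics $$\dot{\widetilde e}=\widetilde v,\qquad \dot{\widetilde v}=f(e+\chi_{\rm d},v,u)-f(\overline e+\chi_{\rm d},\overline v,\overline u)+d .$$ The constants $\alpha_1,\alpha_2>0$ are defined by $$\alpha_1:=1-\frac{L}{2\rho},\qquad \alpha_2:=k\underline J-(1+2\rho)L-\frac54 .$$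
   Context: Robot. In a workspace $\mathcal{W}\subseteq\mathbb{R}^n$ the robot obeys $\dot\chi=v$, $\dot v=f(\chi,v,u)+d$, with state $\chi\in\mathcal{W}$, velocity $v\in\mathcal{V}$ ($\mathcal{V}\subseteq\mathbb{R}^n$ connected, containing the origin), input $u\in\mathcal{U}$ ($\mathcal{U}\subseteq\mathbb{R}^n$ convex, containing the origin), disturbance $d\in\mathcal{D}:=\{d\in\mathbb{R}^n:\|d\|_2\le\widetilde d\}$ with $\widetilde d>0$, and $f:\mathbb{R}^n\times\mathbb{R}^n\times\mathbb{R}^n\to\mathbb{R}^n$ continuous. The nominal system is $\dot{\overline\chi}=\overline v$, $\dot{\overline v}=f(\overline\chi,\overline v,\overline u)$ with $\overline\chi\in\mathcal{W}$, $\overline v\in\mathcal{V}$, $\overline u\in\mathcal{U}$. Errors. $\chi_{\rm d}$ is a fixed desired point (the center of a desired region of the workspace). With $e:=\chi-\chi_{\rm d}$, the uncertain error system is $\dot e=v$, $\dot v=f(e+\chi_{\rm d},v,u)+d$ and the nominal error system is $\dot{\overline e}=\overline v$, $\dot{\overline v}=f(\overline e+\chi_{\rm d},\overline v,\overline u)$. The deviations are $\widetilde e:=e-\overline e$ and $\widetilde v:=v-\overline v$, with $\widetilde e(0)=\widetilde v(0)=0$. The nominal control action $\overline u=\overline u(\overline e,\overline v)\in\mathcal{U}$ is a function of the nominal states. Standing assumptions. (1) $f$ is continuously differentiable with respect to $\chi$, $v$ and $u$ in $\mathcal{W}\times\mathcal{V}\times\mathcal{U}$, with $f(0,0,0)=0$.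 (2) The linear system obtained by Jacobian linearization of the nominal dynamics $\dot{\overline\chi}=\overline v$, $\dot{\overline v}=f(\overline\chi,\overline v,\overline u)$ around the equilibrium $(\chi,v)=(0,0)$ is stabilizable. (3) With $J(\chi,v,u):=[\partial f_i(\chi,v,u)/\partial u_j]_{i,j=1}^n$, there is a constant $\underline J$ with $\lambda_{\min}\big[\tfrac12(J(\chi,v,u)+J(\chi,v,u)^\top)\big]\ge\underline J>0$ for all $\chi\in\mathcal{W}$, $v\in\mathcal{V}$, $u\in\mathcal{U}$. Here $\lambda_{\min}(B)$ denotes the minimum absolute value of the real part of the eigenvalues of $B$. $L:=\max\{L_1,L_2\}$, where $L_1,L_2$ are the Lipschitz constants of $f$ with respect to $\chi$ and $v$, respectively. RCI set. For a dynamical system $\dot x=F(x,u,d)$ with $x\in\mathcal{X}$, $u\in\mathcal{U}$, $d\in\mathcal{D}$ and $x(0)\in\mathcal{X}$, a set $\mathcal{X}'\subseteq\mathcal{X}$ is a Robust Control Invariant set if there exists a feedback control law $u:=\kappa(x)\in\mathcal{U}$ such that for all $x(0)\in\mathcal{X}'$ and for all $d(t)\in\mathcal{D}$ it holds that $x(t)\in\mathcal{X}'$ for all $t\ge0$, along every solution $x(t)$.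
   Formalization: Added: eigenvalues of (J+J^T)/2 are nonnegative (λ_min with absolute values leaves the sign open; f=-u is a counterexample). Invariance is for solutions with zero initial deviations, as in the context, that obey the state and input constraints. *)

(* Defs.v *)
From HB Require Import structures.
From mathcomp Require Import all_boot all_order all_algebra.
From mathcomp Require Import all_classical all_reals all_analysis.
From mathcomp Require Import complex.

Set Implicit Arguments.
Unset Strict Implicit.
Unset Printing Implicit Defensive.

Import Order.TTheory GRing.Theory Num.Theory.
Import numFieldNormedType.Exports.

Local Open Scope classical_set_scope.
Local Open Scope ring_scope.

(* R^n is 'cV[R]_n.  Its library norm is the
   sup norm, which gives the same topology and differentiability as the
   Euclidean norm; quantitative bounds are stated with norm2. *)
Definition norm2 (R : realType) (n : nat) (x : 'cV[R]_n) : R :=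
  Num.sqrt (\sum_i x i 0 ^+ 2).

Definition dist_ball (R : realType) (n : nat) (r : R) : set 'cV[R]_n :=
  [set d | norm2 d <= r].

Definition uncurry3 (R : realType) (n : nat)
    (f : 'cV[R]_n -> 'cV[R]_n -> 'cV[R]_n -> 'cV[R]_n)
    (p : 'cV[R]_n * 'cV[R]_n * 'cV[R]_n) : 'cV[R]_n := f p.1.1 p.1.2 p.2.

(* [d f_i / d chi_j], [d f_i / d v_j] and [d f_i / d u_j] at (chi, v, u) *)
Definition jac_chi (R : realType) (n : nat)
    (f : 'cV[R]_n -> 'cV[R]_n -> 'cV[R]_n -> 'cV[R]_n)
    (chi v u : 'cV[R]_n) : 'M[R]_n :=
  \matrix_(i, j) 'D_(delta_mx j 0) (fun w : 'cV[R]_n => f w v u i 0) chi.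

Definition jac_v (R : realType) (n : nat)
    (f : 'cV[R]_n -> 'cV[R]_n -> 'cV[R]_n -> 'cV[R]_n)
    (chi v u : 'cV[R]_n) : 'M[R]_n :=
  \matrix_(i, j) 'D_(delta_mx j 0) (fun w : 'cV[R]_n => f chi w u i 0) v.

Definition jac_u (R : realType) (n : nat)
    (f : 'cV[R]_n -> 'cV[R]_n -> 'cV[R]_n -> 'cV[R]_n)
    (chi v u : 'cV[R]_n) : 'M[R]_n :=
  \matrix_(i, j) 'D_(delta_mx j 0) (fun w : 'cV[R]_n => f chi v w i 0) u.

(* f is defined on the whole space, so no openness of W, V, U is needed for
   differentiability at their points; continuity of the derivative is only
   required within W x V x U. *)
Definition C1_on (R : realType) (n : nat)
    (f : 'cV[R]_n -> 'cV[R]_n -> 'cV[R]_n -> 'cV[R]_n)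
    (W V U : set 'cV[R]_n) : Prop :=
  [/\ forall p, (W `*` V `*` U) p -> differentiable (uncurry3 f) p,
      {within W `*` V `*` U, continuous (fun p => jac_chi f p.1.1 p.1.2 p.2)},
      {within W `*` V `*` U, continuous (fun p => jac_v f p.1.1 p.1.2 p.2)} &
      {within W `*` V `*` U, continuous (fun p => jac_u f p.1.1 p.1.2 p.2)}].

Definition lipschitz_chi (R : realType) (n : nat)
    (f : 'cV[R]_n -> 'cV[R]_n -> 'cV[R]_n -> 'cV[R]_n)
    (W V U : set 'cV[R]_n) (L : R) : Prop :=
  0 <= L /\ forall chi chi' v u, W chi -> W chi' -> V v -> U u ->
    norm2 (f chi v u - f chi' v u) <= L * norm2 (chi - chi').

Definition lipschitz_v (R : realType) (n : nat)
    (f : 'cV[R]_n -> 'cV[R]_n -> 'cV[R]_n -> 'cV[R]_n)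
    (W V U : set 'cV[R]_n) (L : R) : Prop :=
  0 <= L /\ forall chi v v' u, W chi -> V v -> V v' -> U u ->
    norm2 (f chi v u - f chi v' u) <= L * norm2 (v - v').

Definition ceigenvalue (R : realType) (n : nat) (B : 'M[R]_n)
    (z : R[i]) : Prop :=
  eigenvalue (map_mx (real_complex R) B) z.

(* For n > 0 the set is finite and nonempty, so inf is a minimum.  Because of
   the absolute value, a positive lower bound on lambda_min B keeps the
   eigenvalues away from the imaginary axis but does not fix the sign of their
   real parts. *)
Definition lambda_min (R : realType) (n : nat) (B : 'M[R]_n) : R :=
  inf [set `|complex.Re z| | z in [set z | ceigenvalue B z]].

Definition sym_part (R : realType) (n : nat) (B : 'M[R]_n) : 'M[R]_n :=
  2^-1 *: (B + B^T).

Definition hurwitz (R : realType) (n : nat) (A : 'M[R]_n) : Prop :=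
  forall z, ceigenvalue A z -> complex.Re z < 0.

Definition spectrum_nonneg (R : realType) (n : nat) (B : 'M[R]_n) : Prop :=
  forall z, ceigenvalue B z -> 0 <= complex.Re z.

Definition stabilizable (R : realType) (n m : nat)
    (A : 'M[R]_n) (B : 'M[R]_(n, m)) : Prop :=
  exists K : 'M[R]_(m, n), hurwitz (A + B *m K).

(* Jacobian linearization of chi' = v, v' = f(chi, v, u) at the origin. *)
Definition lin_A (R : realType) (n : nat)
    (f : 'cV[R]_n -> 'cV[R]_n -> 'cV[R]_n -> 'cV[R]_n) : 'M[R]_(n + n) :=
  block_mx 0 1%:M (jac_chi f 0 0 0) (jac_v f 0 0 0).

Definition lin_B (R : realType) (n : nat)
    (f : 'cV[R]_n -> 'cV[R]_n -> 'cV[R]_n -> 'cV[R]_n) : 'M[R]_(n + n, n) :=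
  col_mx 0 (jac_u f 0 0 0).

(* x' = dyn x u d with x in state_set, u in input_set, d in dist_set and
   x(0) in init_set. *)
Record control_system (R : realType) (N m p : nat) := ControlSystem {
  dyn : 'cV[R]_N -> 'cV[R]_m -> 'cV[R]_p -> 'cV[R]_N;
  state_set : set 'cV[R]_N;
  init_set : set 'cV[R]_N;
  input_set : set 'cV[R]_m;
  dist_set : set 'cV[R]_p
}.

(* x' = g in the sense of Caratheodory on [0, +oo[: x is the indefinite
   Lebesgue integral of the locally integrable function g, i.e. x is locally
   absolutely continuous and x'(t) = g(t) for almost every t.  This admits
   disturbances that are merely measurable in time. *)
Definition has_velocity (R : realType) (N : nat) (x g : R -> 'cV[R]_N) : Prop :=
  forall t, 0 <= t -> forall i,
    (@lebesgue_measure R).-integrable `[0, t] (EFin \o (fun s => g s i 0)) /\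
    x t i 0 = x 0 i 0 + \int[@lebesgue_measure R]_(s in `[0, t]) g s i 0.

Definition closed_loop_solution (R : realType) (N m p : nat)
    (S : control_system R N m p) (kappa : 'cV[R]_N -> 'cV[R]_m)
    (d : R -> 'cV[R]_p) (x : R -> 'cV[R]_N) : Prop :=
  [/\ init_set S (x 0),
      forall t, 0 <= t -> state_set S (x t),
      forall t, 0 <= t -> input_set S (kappa (x t)) &
      has_velocity x (fun t => dyn S (x t) (kappa (x t)) (d t))].

(* X' is robust control invariant when such a feedback law kappa exists; the
   law is kept explicit since a specific one is asserted to work. *)
Definition renders_rci (R : realType) (N m p : nat)
    (S : control_system R N m p) (kappa : 'cV[R]_N -> 'cV[R]_m)
    (X' : set 'cV[R]_N) : Prop :=
  X' `<=` state_set S /\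
  forall d x, (forall t, 0 <= t -> dist_set S (d t)) ->
    closed_loop_solution S kappa d x -> X' (x 0) ->
    forall t, 0 <= t -> X' (x t).

(* State of the deviation dynamics driven by the nominal error dynamics:
   x = (e~, v~, ebar, vbar), so that the system is autonomous. *)
Definition dev_e (R : realType) (n : nat) (x : 'cV[R]_(n + n + (n + n))) :
  'cV[R]_n := usubmx (usubmx x).
Definition dev_v (R : realType) (n : nat) (x : 'cV[R]_(n + n + (n + n))) :
  'cV[R]_n := dsubmx (usubmx x).
Definition nom_e (R : realType) (n : nat) (x : 'cV[R]_(n + n + (n + n))) :
  'cV[R]_n := usubmx (dsubmx x).
Definition nom_v (R : realType) (n : nat) (x : 'cV[R]_(n + n + (n + n))) :
  'cV[R]_n := dsubmx (dsubmx x).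
Definition real_e (R : realType) (n : nat) (x : 'cV[R]_(n + n + (n + n))) :
  'cV[R]_n := nom_e x + dev_e x.
Definition real_v (R : realType) (n : nat) (x : 'cV[R]_(n + n + (n + n))) :
  'cV[R]_n := nom_v x + dev_v x.

(* Both the real and the nominal trajectories obey the constraints, and the
   deviations start at 0. *)
Definition deviation_system (R : realType) (n : nat)
    (f : 'cV[R]_n -> 'cV[R]_n -> 'cV[R]_n -> 'cV[R]_n)
    (W V U : set 'cV[R]_n) (dtil : R) (chid : 'cV[R]_n)
    (ubar : 'cV[R]_n -> 'cV[R]_n -> 'cV[R]_n) :
    control_system R (n + n + (n + n)) n n :=
  {| dyn := fun x u d =>
       col_mx
         (col_mx (dev_v x)
            (f (real_e x + chid) (real_v x) u
             - f (nom_e x + chid) (nom_v x) (ubar (nom_e x) (nom_v x)) + d))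
         (col_mx (nom_v x)
            (f (nom_e x + chid) (nom_v x) (ubar (nom_e x) (nom_v x))));
     state_set := [set x | [/\ W (real_e x + chid), V (real_v x),
                               W (nom_e x + chid) & V (nom_v x)]];
     init_set := [set x | dev_e x = 0 /\ dev_v x = 0];
     input_set := U;
     dist_set := @dist_ball R n dtil |}.

Definition kappa (R : realType) (n : nat) (k : R)
    (e ebar v vbar : 'cV[R]_n) : 'cV[R]_n :=
  - (k *: (e - ebar)) - k *: (v - vbar).

Definition control_law (R : realType) (n : nat) (k : R)
    (ubar : 'cV[R]_n -> 'cV[R]_n -> 'cV[R]_n)
    (x : 'cV[R]_(n + n + (n + n))) : 'cV[R]_n :=
  ubar (nom_e x) (nom_v x) + kappa k (real_e x) (nom_e x) (real_v x) (nom_v x).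

Definition alpha1 (R : realType) (L rho : R) : R := 1 - L / (2 * rho).

Definition alpha2 (R : realType) (L rho k J_ : R) : R :=
  k * J_ - (1 + 2 * rho) * L - 5 / 4.

Definition Omega1 (R : realType) (n : nat) (dtil a1 a2 : R) : set 'cV[R]_n :=
  [set e | norm2 e <= dtil / Num.sqrt (Num.min a1 a2)].

Definition Omega2 (R : realType) (n : nat) (dtil a1 a2 : R) : set 'cV[R]_n :=
  [set v | norm2 v <= 2 * dtil / Num.sqrt (Num.min a1 a2)].

(* Main.v *)
Require Import Defs.
From HB Require Import structures.
From mathcomp Require Import all_boot all_order all_algebra.
From mathcomp Require Import all_classical all_reals all_analysis.
From mathcomp Require Import complex spectral ring lra.

Import Order.TTheory GRing.Theory Num.Theory.
Import numFieldNormedType.Exports.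

Local Open Scope classical_set_scope.
Local Open Scope ring_scope.

(* With e the position deviation and z := e + v, the Lyapunov function
   |e|^2 + |z|^2 works: along the closed loop, half its derivative is
   |z|^2 - |e|^2 + z . (f(chi, v, u) - f(chi', v', u')) + z . d, where primes
   mark the nominal quantities.  Changing chi, v and u one at a time, the first
   two increments are bounded by the Lipschitz constants; the third is at most
   - k J |z|^2 because u - u' = - k z and the symmetric part of df/du is bounded
   below on the segment from u' to u.  Young's inequality then bounds the half
   derivative by - alpha1 |e|^2 - alpha2 |z|^2 + dtil^2, which is nonpositive as
   soon as |e|^2 + |z|^2 >= dtil^2 / min(alpha1, alpha2).  Hence |e| and |z|
   never exceed dtil / sqrt(min(alpha1, alpha2)), and |v| <= |e| + |z|. *)

(** * Euclidean norm and quadratic forms of symmetric matrices *)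

Lemma norm2_sqr {R : realType} {n : nat} (x : 'cV[R]_n) :
  norm2 x ^+ 2 = \sum_i x i 0 ^+ 2.
Proof. by rewrite sqr_sqrtr// sumr_ge0// => i _; rewrite sqr_ge0. Qed.

(** Over the complex numbers the spectral theorem writes [B] as [P^-1 D P] with [P] unitary and [D]
    real diagonal. In the coordinates [y = P x] the form is the sum of [D_i |y_i|^2], while the norm
    is unchanged. *)
Lemma quadform_ge {R : realType} {n : nat} (B : 'M[R]_n) (c : R) :
  B^T = B -> (forall z, ceigenvalue B z -> c <= complex.Re z) ->
  forall x : 'cV[R]_n, c * norm2 x ^+ 2 <= (x^T *m B *m x) 0 0.
Proof.
move=> Bsym Bge x; set toC := real_complex R; pose A := map_mx toC B.
have toC_conj (r : R) : (toC r)^* = toC r :> R[i].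
  by apply: CrealP; apply/complex_realP; exists r.
have Areal : A \is a mxOver Num.real.
  by apply/mxOverP => i j; rewrite mxE; apply/complex_realP; exists (B i j).
have Aherm : A \is hermsymmx.
  apply: realsym_hermsym => //; apply/is_hermitianmxP.
  rewrite expr0 scale1r map_mx_id//.
  by rewrite /A map_trmx Bsym.
have /orthomx_spectralP := hermitian_normalmx Aherm.
have := hermitian_spectral_diag_real Aherm.
have := spectral_unitarymx A.
move: (spectralmx A) (spectral_diag A) => P D Pu Dreal AE.
have Punit := unitarymx_unit Pu.
(* Row [i] of [P] is a left eigenvector for [D 0 i], nonzero because [P] is invertible. *)
have Dge i : toC c <= D 0 i.
  have Di : D 0 i \is Num.real by have /mxOverP := Dreal; apply.
  rewrite -(RRe_real Di) lecR; apply: Bge; apply/eigenvalueP.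
  exists (row i P); last first.
    apply/eqP => Pi0; have := row_mul i P (invmx P).
    rewrite mulmxV// Pi0 mul0mx => /rowP/(_ i); rewrite !mxE eqxx => /eqP.
    by rewrite oner_eq0.
  rewrite -/toC -/A AE -row_mul !mulmxA mulmxV// mul1mx.
  by rewrite row_mul row_diag_mx -scalemxAl -rowE.
pose z := map_mx toC x.
have [y yE] : exists y, y = P *m z by exists (P *m z).
have adj_mul m p q (M : 'M[R[i]]_(m, p)) (N : 'M[R[i]]_(p, q)) :
    (map_mx Num.conj (M *m N)^T) = map_mx Num.conj N^T *m map_mx Num.conj M^T.
  by rewrite trmx_mul map_mxM.
(* The entries of [z] are real, so its transpose is also its adjoint. *)
have zJ : map_mx Num.conj z^T = z^T.
  by apply/matrixP => i j; rewrite !mxE toC_conj.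
have quadE : toC ((x^T *m B *m x) 0 0) = \sum_i D 0 i * `|y i 0| ^+ 2.
  have -> : toC ((x^T *m B *m x) 0 0) = (z^T *m A *m z) 0 0.
    by rewrite /z /A map_trmx -!map_mxM [RHS]mxE.
  rewrite AE invmx_unitary// -zJ !mulmxA -adj_mul -mulmxA -yE mxE.
  by apply: eq_bigr => i _; rewrite mul_mx_diag !mxE normCK; ring.
have normE : toC (norm2 x ^+ 2) = \sum_i `|y i 0| ^+ 2.
  rewrite norm2_sqr /toC rmorph_sum/= -/toC.
  have <- : (z^T *m z) 0 0 = \sum_i toC (x i 0 ^+ 2).
    by rewrite mxE; apply: eq_bigr => i _; rewrite !mxE expr2 /toC rmorphM.
  have -> : z^T *m z = map_mx Num.conj y^T *m y.
    rewrite yE adj_mul -mulmxA [_ *m (P *m z)]mulmxA.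
    by rewrite -(invmx_unitary Pu) mulVmx// mul1mx zJ.
  by rewrite mxE; apply: eq_bigr => i _; rewrite !mxE normCK mulrC.
rewrite -lecR -/toC quadE /toC rmorphM/= -/toC normE mulr_sumr ler_sum// => i _.
by rewrite ler_wpM2r// exprn_ge0.
Qed.

(** * Euclidean inner product and the Cauchy-Schwarz inequality *)

Definition dot {R : realType} {n : nat} (x y : 'cV[R]_n) : R :=
  \sum_i x i 0 * y i 0.

Lemma dotC {R : realType} {n : nat} (x y : 'cV[R]_n) : dot x y = dot y x.
Proof. by apply: eq_bigr => i _; rewrite mulrC. Qed.

Lemma dotDr {R : realType} {n : nat} (x y z : 'cV[R]_n) :
  dot x (y + z) = dot x y + dot x z.
Proof. by rewrite -big_split; apply: eq_bigr => i _; rewrite mxE mulrDr. Qed.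

Lemma dotZr {R : realType} {n : nat} (a : R) (x y : 'cV[R]_n) :
  dot x (a *: y) = a * dot x y.
Proof. by rewrite mulr_sumr; apply: eq_bigr => i _; rewrite mxE mulrCA. Qed.

Lemma dotBr {R : realType} {n : nat} (x y z : 'cV[R]_n) :
  dot x (y - z) = dot x y - dot x z.
Proof. by rewrite -scaleN1r dotDr dotZr mulN1r. Qed.

Lemma dotZl {R : realType} {n : nat} (a : R) (x y : 'cV[R]_n) :
  dot (a *: x) y = a * dot x y.
Proof. by rewrite dotC dotZr dotC. Qed.

Lemma dotBl {R : realType} {n : nat} (x y z : 'cV[R]_n) :
  dot (x - y) z = dot x z - dot y z.
Proof. by rewrite dotC dotBr ![dot z _]dotC. Qed.

Lemma dotxx {R : realType} {n : nat} (x : 'cV[R]_n) : dot x x = norm2 x ^+ 2.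
Proof. by rewrite norm2_sqr; apply: eq_bigr => i _; rewrite expr2. Qed.

Lemma norm2_ge0 {R : realType} {n : nat} (x : 'cV[R]_n) : 0 <= norm2 x.
Proof. exact: sqrtr_ge0. Qed.

Lemma norm2Z {R : realType} {n : nat} (a : R) (x : 'cV[R]_n) :
  norm2 (a *: x) ^+ 2 = a ^+ 2 * norm2 x ^+ 2.
Proof. by rewrite -!dotxx dotZl dotZr; ring. Qed.

(** Expanding [|a x - b y|^2 >= 0] with [a = |y|] and [b = |x|] gives the bound after division by
    [|x| |y|]; a vanishing norm needs other weights. *)
Lemma dot_le_norm2 {R : realType} {n : nat} (x y : 'cV[R]_n) :
  dot x y <= norm2 x * norm2 y.
Proof.
have sq_ge0 (a b : R) : 0 <= a ^+ 2 * norm2 x ^+ 2 - 2 * a * b * dot x y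
    + b ^+ 2 * norm2 y ^+ 2.
  have := sqr_ge0 (norm2 (a *: x - b *: y)).
  by rewrite -[norm2 (_ - _) ^+ 2]dotxx dotBr !dotBl !dotZr !dotZl !dotxx
    [dot y x]dotC; lra.
have x0 := norm2_ge0 x; have y0 := norm2_ge0 y.
(* If [|x| = 0], the weights [|y|^2 + 1] and [dot x y] leave [- (|y|^2 + 2) (dot x y)^2 >= 0], which
   forces [dot x y = 0]; likewise with [x] and [y] exchanged. *)
have degenerate a : 0 <= a -> 0 <= - ((a + 2) * dot x y ^+ 2) -> dot x y <= 0.
  move=> a0; rewrite oppr_ge0 pmulr_rle0; last by lra.
  by rewrite real_exprn_even_le0//= => /eqP ->.
move: x0; rewrite le_eqVlt => /predU1P[x0|x0].
  rewrite -x0 mul0r; apply: (degenerate (norm2 y ^+ 2)); first exact: sqr_ge0.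
  by have := sq_ge0 (norm2 y ^+ 2 + 1) (dot x y); rewrite -x0; lra.
move: y0; rewrite le_eqVlt => /predU1P[y0|y0].
  rewrite -y0 mulr0; apply: (degenerate (norm2 x ^+ 2)); first exact: sqr_ge0.
  by have := sq_ge0 (dot x y) (norm2 x ^+ 2 + 1); rewrite -y0; lra.
rewrite -(ler_pM2l (mulr_gt0 x0 y0)).
by have := sq_ge0 (norm2 y) (norm2 x); lra.
Qed.

Lemma norm2B_le {R : realType} {n : nat} (x y : 'cV[R]_n) :
  norm2 (x - y) <= norm2 x + norm2 y.
Proof.
rewrite -(ler_pXn2r (n := 2))// ?nnegrE ?addr_ge0 ?norm2_ge0//.
rewrite -[norm2 (x - y) ^+ 2]dotxx dotBr !dotBl !dotxx.
have := dot_le_norm2 x (- y); rewrite -scaleN1r dotZr.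
have : norm2 (-1 *: y) = norm2 y.
  by rewrite /norm2; under eq_bigr do rewrite mxE mulN1r sqrrN.
by move=> ->; rewrite [dot y x]dotC; lra.
Qed.

(** * Barrier argument and trajectories in the sense of Caratheodory *)

(** Continuity alone prolongs [phi < 0], so a hypothesis is required only at the zeros of [phi]. *)
Lemma no_crossing {R : realType} (phi : R -> R) (T : R) : 0 <= T ->
  {within `[0, T], continuous phi} -> phi 0 <= 0 ->
  (forall t, 0 <= t -> t < T -> phi t = 0 ->
    \forall s \near t, t <= s <= T -> phi s <= 0) ->
  phi T <= 0.
Proof.
move=> T0 /subspace_continuousP cphi phi0 step.
rewrite leNgt; apply/negP => phiT.
(* [sup A] is the last time before [T] at which [phi <= 0]. *)
pose A := [set t | 0 <= t <= T /\ phi t <= 0].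
have A0 : A 0 by split => //; rewrite lexx.
have Aub : ubound A T by move=> t [/andP[]].
have supA : has_sup A by split; [exists 0 | exists T].
set t0 := sup A.
have t0_ge0 : 0 <= t0 by exact: sup_upper_bound A0.
have t0_leT : t0 <= T by exact: (ge_sup supA.1 Aub).
have t0T : `[0, T]%classic t0 by rewrite /= in_itv/= t0_ge0.
(* If [t0 < T], the point [s] would belong to [A] beyond its supremum. *)
have after (P : \forall s \near t0, t0 <= s <= T -> phi s <= 0) : t0 = T.
  apply/eqP; rewrite eq_le t0_leT leNgt; apply/negP => t0ltT.
  have [d /= d0 dP] := P.
  pose s := Num.min T (t0 + d / 2).
  have t0s : t0 < s by rewrite lt_min t0ltT ltrDl divr_gt0.
  have sT : s <= T by rewrite ge_min lexx.
  have sd : s <= t0 + d / 2 by rewrite ge_min lexx orbT.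
  have As : A s.
    split; first by rewrite sT (le_trans t0_ge0 (ltW t0s)).
    by apply: dP; rewrite /= ?sT ?(ltW t0s)// ltr0_norm; lra.
  by have := sup_upper_bound supA As; rewrite leNgt t0s.
have [phit0|phit0|phit0] := ltgtP (phi t0) 0.
- have : t0 = T.
    apply: after; have := cphi _ t0T => /cvgr_lt /(_ _ phit0).
    rewrite near_withinE; apply: filterS => s sP /andP[t0s sT]; apply: ltW.
    by apply: sP; rewrite /= in_itv/= sT (le_trans t0_ge0).
  by move=> t0E; move: phit0; rewrite t0E ltNge ltW.
(* Positivity at [t0] would extend to nearby times, but elements of [A] lie arbitrarily close to
   [t0]. *)
- have := cphi _ t0T => /cvgr_gt /(_ _ phit0).
  rewrite near_withinE => -[d /= d0 dP].
  have [a [/andP[a0 aT] phia] ta] := sup_adherent d0 supA.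
  have at0 : a <= t0 by apply: (sup_upper_bound supA); split => //; rewrite a0.
  have : 0 < phi a.
    apply: dP; rewrite /= ?in_itv/= ?a0 ?aT// ger0_norm ?subr_ge0//.
    by rewrite -/t0 in ta; lra.
  by rewrite ltNge phia.
- have [t0ltT|] := ltP t0 T.
    have t0E : t0 = T by apply: after; exact: step.
    by move: phiT; rewrite -t0E phit0 ltxx.
  move=> Tt0; have t0E : t0 = T by apply/le_anti; rewrite t0_leT.
  by move: phiT; rewrite -t0E phit0 ltxx.
Qed.

Lemma integrable_sumr {d} {T : measurableType d} {R : realType}
    (mu : {measure set T -> \bar R}) (D : set T) (I : Type) (r : seq I)
    (F : I -> T -> R) : measurable D ->
  (forall i, mu.-integrable D (EFin \o F i)) ->
  mu.-integrable D (EFin \o (fun x => \sum_(i <- r) F i x)).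
Proof.
move=> mD Fint.
rewrite (_ : EFin \o _ = fun x => (\sum_(i <- r) (EFin \o F i) x)%E).
  exact: integrable_sum.
by apply/funext => x /=; rewrite -sumEFin.
Qed.

Lemma Rintegral_sum {d} {T : measurableType d} {R : realType}
    (mu : {measure set T -> \bar R}) (D : set T) (I : Type) (r : seq I)
    (F : I -> T -> R) : measurable D ->
  (forall i, mu.-integrable D (EFin \o F i)) ->
  \int[mu]_(x in D) \sum_(i <- r) F i x =
  \sum_(i <- r) \int[mu]_(x in D) F i x.
Proof.
move=> mD Fint; elim: r => [|i r IHr].
  under eq_Rintegral do rewrite big_nil.
  by rewrite Rintegral_cst// mul0r big_nil.
under eq_Rintegral do rewrite big_cons.
by rewrite RintegralD// ?IHr ?big_cons//; exact: integrable_sumr.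
Qed.

(* For solutions in the sense of Caratheodory.  A product rule is avoided: where
   [c <= |y|^2] and [y] varies by at most [e / 2], the increment of [|y|^2] is
   the integral of [(y s + y t) . g], which is [2 y . g] up to [2 e |g|]. *)
Lemma bounded_of_decay {R : realType} {N : nat} (y g : R -> 'cV[R]_N) (c : R) :
  has_velocity y g -> norm2 (y 0) ^+ 2 <= c ->
  (forall t : R, 0 <= t -> c <= norm2 (y t) ^+ 2 ->
    dot (y t) (g t) <= 0) ->
  forall t : R, 0 <= t -> norm2 (y t) ^+ 2 <= c.
Proof.
move=> yg y0 decay T T0; set mu := @lebesgue_measure R.
pose V s := \sum_i y s i 0 ^+ 2.
have VE s : norm2 (y s) ^+ 2 = V s by rewrite norm2_sqr.
pose h s : R := \sum_i `|g s i 0|.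
pose G s := \int[mu]_(r in `[0, s]) h r.
have h_int (t : R) : 0 <= t -> mu.-integrable `[0, t] (EFin \o h).
  move=> t0; apply: integrable_sumr => // i.
  exact: integrable_norm (yg t t0 i).1.
have G0 : 0 <= G T by apply: Rintegral_ge0 => s _; exact: sumr_ge0.
have ycont i : {within `[0, T], continuous (fun s => y s i 0)}.
  have /= C := parameterized_integral_continuous T0 (yg T T0 i).1.
  have {}C : {within `[0, T], continuous
      (fun s => y 0 i 0 + \int[mu]_(r in `[0, s]) g r i 0)}.
    by move=> s; apply: cvgD; [exact: cvg_cst|exact: C].
  apply: subspace_eq_continuous C => s; rewrite inE/= in_itv/= => /andP[s0 _].
  exact/esym/(yg s s0 i).2.
have Gcont : {within `[0, T], continuous G}.
  exact: parameterized_integral_continuous (h_int T T0).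
have Vcont : {within `[0, T], continuous V}.
  move=> s; apply: cvg_big; first exact: add_continuous.
  move=> i _; apply: (@cvg_comp _ _ _ (fun r => y r i 0) (fun a => a ^+ 2)).
    exact: ycont.
  exact: exprn_continuous.
(* The constant [c] is replaced by a barrier growing at rate [2 e h]. Where [V] meets it, [V] is
   strictly above [c], so [decay] applies at all nearby times, and the growth of the barrier absorbs
   the error in the increments. *)
have bound e : 0 < e -> V T <= c + e * (2 * G T + 1).
  move=> e0; rewrite -subr_le0.
  pose phi s := V s - (c + e * (2 * G s + 1)).
  apply: (@no_crossing _ phi) => //.
  - move=> s; apply: cvgB; first exact: Vcont.
    apply: cvgD; first exact: cvg_cst.
    apply: cvgM; first exact: cvg_cst.
    apply: cvgD; last exact: cvg_cst.
    apply: cvgM; [exact: cvg_cst|exact: Gcont].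
  - rewrite /phi /G set_itv1 Rintegral_set1 -VE; lra.
  move=> t t0 tT phit.
  have tT' : `[0, T]%classic t by rewrite /= in_itv/= t0 ltW.
  have Gt0 : 0 <= G t by apply: Rintegral_ge0 => s _; exact: sumr_ge0.
  have Vt : c < V t.
    by move: phit; rewrite /phi => /eqP; rewrite subr_eq0 => /eqP ->; nra.
  have nearV : \forall s \near t, `[0, T]%classic s -> c < V s.
    move/subspace_continuousP : Vcont => /(_ _ tT')/cvgr_gt/(_ _ Vt).
    by rewrite near_withinE.
  have neary : \forall s \near t, `[0, T]%classic s ->
      forall i, `|y t i 0 - y s i 0| < e / 2.
    suff : \forall s \near within `[0, T]%classic (nbhs t),
        forall i, `|y t i 0 - y s i 0| < e / 2 by rewrite near_withinE.
    apply: filter_forall => i.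
    move/subspace_continuousP : (ycont i) => /(_ _ tT')/cvgrPdist_lt; apply.
    by rewrite divr_gt0.
  have [d /= d0 dP] := filterI nearV neary.
  exists d => //= s ts /andP[tles sT].
  have s0 := le_trans t0 tles.
  have incr i : y s i 0 - y t i 0 = \int[mu]_(r in `]t, s]) g r i 0.
    rewrite (yg s s0 i).2 (yg t t0 i).2 opprD addrACA subrr add0r.
    by rewrite Rintegral_itvB ?bnd_simp//; exact: (yg s s0 i).1.
  have sub : `]t, s] `<=` `[0, s] by apply: subset_itvr; rewrite bnd_simp.
  have gint i : mu.-integrable `]t, s] (EFin \o (fun r => g r i 0)).
    by apply: integrableS (yg s s0 i).1.
  have hint : mu.-integrable `]t, s] (EFin \o h).
    by apply: integrableS (h_int s s0).
  have cint i (a : R) : mu.-integrable `]t, s] (EFin \o (fun r => a * g r i 0)).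
    by have := @integrableZl _ _ _ mu _ _ a _ (gint i); apply.
  have VB : V s - V t =
      \int[mu]_(r in `]t, s]) \sum_i (y s i 0 + y t i 0) * g r i 0.
    rewrite Rintegral_sum//; under [RHS]eq_bigr do rewrite RintegralZl// -incr.
    by rewrite -sumrB; apply: eq_bigr => i _; ring.
  have GB : G s - G t = \int[mu]_(r in `]t, s]) h r.
    by rewrite /G Rintegral_itvB ?bnd_simp//; exact: h_int.
  (* The right-hand side is exactly the rise of the barrier between [t] and [s]. *)
  suff : V s - V t <= 2 * e * (G s - G t).
    by move: phit; rewrite /phi; lra.
  rewrite VB GB -RintegralZl//; apply: le_Rintegral => //.
  - exact: integrable_sumr.
  - by have := @integrableZl _ _ _ mu _ _ (2 * e) _ hint; apply.
  move=> r; rewrite /= in_itv/= => /andP[tr rs].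
  have r0 : 0 <= r by rewrite (le_trans t0)// ltW.
  have [Vr yr] : c < V r /\ forall i, `|y t i 0 - y r i 0| < e / 2.
    have rT : `[0, T]%classic r by rewrite /= in_itv/= r0 (le_trans rs).
    have [|+ +] := dP r; last by move=> /(_ rT) + /(_ rT).
    rewrite /= (le_lt_trans _ ts)// !ler0_norm ?subr_le0 ?(ltW tr)//; lra.
  have ys i : `|y t i 0 - y s i 0| < e / 2.
    have sT' : `[0, T]%classic s by rewrite /= in_itv/= s0.
    by have [_] := dP s ts; apply.
  have dec : dot (y r) (g r) <= 0 by apply: decay => //; rewrite VE ltW.
  apply: (@le_trans _ _ (2 * dot (y r) (g r) + 2 * e * h r)); last by lra.
  rewrite !mulr_sumr -big_split/= ler_sum// => i _.
  (* Coordinatewise [w = y s + y t - 2 y r]; variations below [e / 2] bound it by [3 e / 2]. *)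
  have [w wE ->] : exists2 w, `|w| < 2 * e &
      (y s i 0 + y t i 0) * g r i 0 = 2 * (y r i 0 * g r i 0) + w * g r i 0.
    exists ((y t i 0 - y r i 0) *+ 2 - (y t i 0 - y s i 0)); last by ring.
    have := yr i; have := ys i; rewrite !ltr_norml; lra.
  rewrite lerD2l (le_trans (ler_norm _))// normrM ler_wpM2r// ltW//.
rewrite VE; apply/ler_addgt0Pr => e e0.
(* The tolerance is rescaled so that the excess over [c] at time [T] is exactly [e]. *)
have := bound (e / (2 * G T + 1)); rewrite divfK ?gt_eqF//; last by lra.
by apply; rewrite divr_gt0//; lra.
Qed.

(** * Strong monotonicity of the dynamics in the input *)

(** [lambda_min] is an infimum of absolute values; nonnegativity of the spectrum turns it into a
    lower bound for the real parts themselves. *)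
Lemma lambda_min_le_Re {R : realType} {n : nat} (B : 'M[R]_n) (z : R[i]) :
  spectrum_nonneg B -> ceigenvalue B z -> lambda_min B <= complex.Re z.
Proof.
move=> Bge0 Bz; rewrite -[leRHS]ger0_norm; last exact: Bge0.
apply: ge_inf; last by exists z.
by exists 0 => _ [w _ <-].
Qed.

(** The skew part contributes nothing, since a scalar equals its own transpose. *)
Lemma dot_sym_part {R : realType} {n : nat} (B : 'M[R]_n) (x : 'cV[R]_n) :
  dot x (B *m x) = (x^T *m sym_part B *m x) 0 0.
Proof.
have dotE (y : 'cV[R]_n) : dot x y = (x^T *m y) 0 0.
  by rewrite mxE; apply: eq_bigr => i _; rewrite mxE.
have trE : (x^T *m B^T *m x) 0 0 = (x^T *m B *m x) 0 0.
  have -> : x^T *m B^T *m x = (x^T *m B *m x)^T.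
    by rewrite !trmx_mul trmxK mulmxA.
  by rewrite mxE.
rewrite dotE /sym_part -scalemxAr -scalemxAl mulmxDr mulmxDl.
by rewrite mulmxA [RHS]mxE [X in _ * X]mxE trE; field.
Qed.

Lemma is_derive_line {R : realType} {V : normedModType R} (g : V -> R)
    (q w : V) (s : R) :
  differentiable g (s *: w + q) ->
  is_derive s 1 (fun r => g (r *: w + q)) ('D_w g (s *: w + q)).
Proof.
move=> dg.
have lineE (h : R) : (h *: 1 + s) *: w + q = h *: w + (s *: w + q).
  by rewrite scalerDl scaler1 addrA.
have E : (fun h : R => h^-1 *: (((fun r => g (r *: w + q)) \o shift s) (h *: 1)
                               - g (s *: w + q)))
       = (fun h : R => h^-1 *: ((g \o shift (s *: w + q)) (h *: w)
                               - g (s *: w + q))).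
  by apply/funext => h; rewrite /= lineE.
have dw := @diff_derivable _ _ _ g _ w dg.
split; first by rewrite /derivable E.
by rewrite /derive E.
Qed.

(** The differential is linear, hence determined by its values on the basis vectors, which are the
    entries of [jac_u]. *)
Lemma derive_coord_jac_u {R : realType} {n : nat}
    (f : 'cV[R]_n -> 'cV[R]_n -> 'cV[R]_n -> 'cV[R]_n)
    (chi v u w : 'cV[R]_n) (i : 'I_n) :
  differentiable (fun q => f chi v q i 0) u ->
  'D_w (fun q => f chi v q i 0) u = (jac_u f chi v u *m w) i 0.
Proof.
move=> df; rewrite deriveE// {1}[w]matrix_sum_delta mxE.
under eq_bigr do rewrite big_ord1.
rewrite linear_sum; apply: eq_bigr => j _.
by rewrite linearZ mxE deriveE// mulrC.
Qed.

Lemma convex_set_segment {R : realType} {n : nat} (U : set 'cV[R]_n)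
    (u u' : 'cV[R]_n) (s : R) : convex_set U -> U u -> U u' ->
  0 <= s -> s <= 1 -> U (s *: (u' - u) + u).
Proof.
move=> Uconv Uu Uu' s0 s1.
have := Uconv u' u (Itv01 s0 s1); rewrite !inE => /(_ Uu' Uu).
have -> // : conv (Itv01 s0 s1) (u' : convex_lmodType _) u = s *: (u' - u) + u.
change (s *: u' + (1 - s) *: u = s *: (u' - u) + u).
by rewrite scalerBr scalerBl scale1r addrCA [RHS]addrC.
Qed.

Lemma differentiable_coord_u {R : realType} {n : nat}
    (f : 'cV[R]_n -> 'cV[R]_n -> 'cV[R]_n -> 'cV[R]_n)
    (chi v u : 'cV[R]_n) (i : 'I_n) :
  differentiable (uncurry3 f) (chi, v, u) ->
  differentiable (fun q => f chi v q i 0) u.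
Proof.
move=> df.
have d1 : differentiable (fun p : 'cV[R]_n => (chi, v, p)) u.
  by apply: differentiable_pair => //; exact: differentiable_cst.
have d2 := differentiable_comp d1 df.
exact: (differentiable_comp d2 (@differentiable_coord _ _ _ _ i 0)).
Qed.

Lemma is_derive_dot_u {R : realType} {n : nat}
    (f : 'cV[R]_n -> 'cV[R]_n -> 'cV[R]_n -> 'cV[R]_n)
    (chi v u w : 'cV[R]_n) (s : R) :
  differentiable (uncurry3 f) (chi, v, s *: w + u) ->
  is_derive s 1 (fun r => dot w (f chi v (r *: w + u)))
    (dot w (jac_u f chi v (s *: w + u) *m w)).
Proof.
move=> df.
have -> : (fun r => dot w (f chi v (r *: w + u)))
    = \sum_(i < n) (w i 0 \*: (fun r => f chi v (r *: w + u) i 0)).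
  by apply/funext => r; rewrite fct_sumE.
apply: is_derive_sum => i; apply: is_deriveZ.
rewrite -derive_coord_jac_u; last exact: differentiable_coord_u.
by apply: is_derive_line; exact: differentiable_coord_u.
Qed.

Lemma derive_ge_increment {R : realType} (phi dphi : R -> R) (c : R) :
  (forall s : R, 0 <= s -> s <= 1 -> is_derive s 1 phi (dphi s)) ->
  (forall s : R, 0 <= s -> s <= 1 -> c <= dphi s) -> c <= phi 1 - phi 0.
Proof.
move=> phi_derive cdphi.
have [||s /[!in_itv]/= /andP[s0 s1] ->] := @MVT_segment R phi dphi 0 1 ler01.
- by move=> s; rewrite in_itv/= => /andP[s0 s1]; apply: phi_derive; exact: ltW.
- apply: derivable_within_continuous => s; rewrite in_itv/= => /andP[s0 s1].
  by have [] := phi_derive s s0 s1.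
by rewrite subr0 mulr1 cdphi.
Qed.

(** Convexity keeps the segment from [u] to [u'] in [U]. Along it, [dot w f] has derivative
    [w . J w], the quadratic form of the symmetric part of the Jacobian, hence at least [c |w|^2];
    the mean value theorem transfers this to the increment. *)
Lemma strongly_monotone_u {R : realType} {n : nat} (U : set 'cV[R]_n)
    (f : 'cV[R]_n -> 'cV[R]_n -> 'cV[R]_n -> 'cV[R]_n) (chi v : 'cV[R]_n)
    (c : R) : convex_set U ->
  (forall u, U u -> differentiable (uncurry3 f) (chi, v, u)) ->
  (forall u, U u -> c <= lambda_min (sym_part (jac_u f chi v u))) ->
  (forall u, U u -> spectrum_nonneg (sym_part (jac_u f chi v u))) ->
  forall u u', U u -> U u' ->
    c * norm2 (u' - u) ^+ 2 <= dot (u' - u) (f chi v u' - f chi v u).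
Proof.
move=> Uconv df cmin cpos u u' Uu Uu'; set w := u' - u.
have Uq (s : R) : 0 <= s -> s <= 1 -> U (s *: w + u).
  exact: convex_set_segment.
have := @derive_ge_increment _ (fun s => dot w (f chi v (s *: w + u)))
  (fun s => dot w (jac_u f chi v (s *: w + u) *m w)) (c * norm2 w ^+ 2).
rewrite scale1r scale0r add0r -dotBr [w + u]subrK; apply=> s s0 s1.
  by apply: is_derive_dot_u; apply: df; exact: Uq.
have Us := Uq s s0 s1; rewrite dot_sym_part; apply: quadform_ge => [|z Bz].
  by rewrite /sym_part linearZ/= linearD/= trmxK addrC.
by rewrite (le_trans (cmin _ Us))// lambda_min_le_Re//; exact: cpos.
Qed.

(** * Velocities of blocks, sums and stacked trajectories *)

Lemma has_velocity_usubmx {R : realType} {p q : nat}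
    (x g : R -> 'cV[R]_(p + q)) :
  has_velocity x g ->
  has_velocity (fun t => usubmx (x t)) (fun t => usubmx (g t)).
Proof.
move=> xg t t0 i; have [gi xi] := xg t t0 (lshift q i).
by under eq_Rintegral do rewrite mxE; rewrite 2!mxE; split=> //;
  apply: eq_integrable gi => // s _; rewrite /= mxE.
Qed.

Lemma has_velocity_dsubmx {R : realType} {p q : nat}
    (x g : R -> 'cV[R]_(p + q)) :
  has_velocity x g ->
  has_velocity (fun t => dsubmx (x t)) (fun t => dsubmx (g t)).
Proof.
move=> xg t t0 i; have [gi xi] := xg t t0 (rshift p i).
by under eq_Rintegral do rewrite mxE; rewrite 2!mxE; split=> //;
  apply: eq_integrable gi => // s _; rewrite /= mxE.
Qed.

Lemma has_velocityD {R : realType} {p : nat} (x x' g g' : R -> 'cV[R]_p) :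
  has_velocity x g -> has_velocity x' g' ->
  has_velocity (fun t => x t + x' t) (fun t => g t + g' t).
Proof.
move=> xg xg' t t0 i; have [gi xi] := xg t t0 i; have [gi' xi'] := xg' t t0 i.
under eq_Rintegral do rewrite mxE.
rewrite RintegralD// [LHS in _ /\ LHS = _]mxE [(x 0 + x' 0) i 0]mxE xi xi'.
split; last by rewrite addrACA.
apply: eq_integrable (integrableD _ gi gi') => // s _.
by rewrite /= mxE EFinD.
Qed.

Lemma has_velocity_col_mx {R : realType} {p q : nat} (x g : R -> 'cV[R]_p)
    (x' g' : R -> 'cV[R]_q) :
  has_velocity x g -> has_velocity x' g' ->
  has_velocity (fun t => col_mx (x t) (x' t)) (fun t => col_mx (g t) (g' t)).
Proof.
move=> xg xg' t t0 i; case: (split_ordP i) => j ->.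
- have [gi xi] := xg t t0 j; under eq_Rintegral do rewrite col_mxEu.
  rewrite !col_mxEu; split=> //; apply: eq_integrable gi => // s _.
  by rewrite /= col_mxEu.
- have [gi xi] := xg' t t0 j; under eq_Rintegral do rewrite col_mxEd.
  rewrite !col_mxEd; split=> //; apply: eq_integrable gi => // s _.
  by rewrite /= col_mxEd.
Qed.

Lemma dot_col_mx {R : realType} {p q : nat} (x x' : 'cV[R]_p)
    (y y' : 'cV[R]_q) :
  dot (col_mx x y) (col_mx x' y') = dot x x' + dot y y'.
Proof.
rewrite /dot big_split_ord /=; congr (_ + _).
  by apply: eq_bigr => i _; rewrite !col_mxEu.
by apply: eq_bigr => i _; rewrite !col_mxEd.
Qed.

Lemma norm2_col_mx {R : realType} {p q : nat} (x : 'cV[R]_p) (y : 'cV[R]_q) :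
  norm2 (col_mx x y) ^+ 2 = norm2 x ^+ 2 + norm2 y ^+ 2.
Proof. by rewrite -!dotxx dot_col_mx. Qed.

(** * Lyapunov estimate and the choice of gains *)

(** Here [d1], [d2], [d3] stand for the increments of the dynamics in position, velocity and input,
    and [d] for the disturbance. *)
Lemma lyapunov_decay {R : realType} {n : nat} (e v d1 d2 d3 d : 'cV[R]_n)
    (L rho k J D : R) : 0 < rho -> 0 <= L -> 0 < k ->
  norm2 d1 <= L * norm2 e -> norm2 d2 <= L * norm2 v -> norm2 d <= D ->
  J * norm2 (- k *: (e + v)) ^+ 2 <= dot (- k *: (e + v)) d3 ->
  dot e v + dot (e + v) (v + (d1 + d2 + d3 + d)) <=
  - alpha1 L rho * norm2 e ^+ 2 - alpha2 L rho k J * norm2 (e + v) ^+ 2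
  + D ^+ 2.
Proof.
move=> rho0 L0 k0 d1L d2L dD; set z := e + v => d3J.
have vE : v = z - e by rewrite /z addrC addKr.
have e0 := norm2_ge0 e; have z0 := norm2_ge0 z.
have vle : norm2 v <= norm2 z + norm2 e by rewrite vE norm2B_le.
have zd1 : dot z d1 <= L * (norm2 z * norm2 e).
  by rewrite (le_trans (dot_le_norm2 _ _))// mulrCA ler_wpM2l.
have zd2 : dot z d2 <= L * (norm2 z * (norm2 z + norm2 e)).
  rewrite (le_trans (dot_le_norm2 _ _))// mulrCA ler_wpM2l//.
  by rewrite (le_trans d2L)// ler_wpM2l.
(* The input increment is [- k z], so dividing the monotonicity bound by [k] leaves a dissipation
   [k J |z|^2]. *)
have zd3 : dot z d3 <= - (k * J * norm2 z ^+ 2).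
  move: d3J; rewrite norm2Z dotZl => d3J.
  by rewrite -(ler_pM2l k0); lra.
(* This [1 / 4] and the [|z|^2] in [ev] make up the [5 / 4] of [alpha2]. *)
have zd : dot z d <= norm2 z ^+ 2 / 4 + D ^+ 2.
  rewrite (le_trans (dot_le_norm2 _ _))//.
  have := sqr_ge0 (norm2 z / 2 - norm2 d).
  have : norm2 d ^+ 2 <= D ^+ 2.
    by rewrite ler_pXn2r ?nnegrE ?norm2_ge0// (le_trans (norm2_ge0 d)).
  lra.
(* Young's inequality: [2 z e <= 2 rho z^2 + e^2 / (2 rho)] *)
have young : L * (2 * (norm2 z * norm2 e)) <=
    L * (2 * rho * norm2 z ^+ 2 + norm2 e ^+ 2 / (2 * rho)).
  rewrite ler_wpM2l// -subr_ge0.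
  have -> : 2 * rho * norm2 z ^+ 2 + norm2 e ^+ 2 / (2 * rho)
      - 2 * (norm2 z * norm2 e)
      = (2 * rho * norm2 z - norm2 e) ^+ 2 / (2 * rho).
    by field; rewrite gt_eqF.
  by rewrite divr_ge0 ?sqr_ge0// mulr_ge0// ltW.
have a1E : alpha1 L rho * norm2 e ^+ 2
    = norm2 e ^+ 2 - L * (norm2 e ^+ 2 / (2 * rho)).
  by rewrite /alpha1; field; rewrite gt_eqF.
have ev : dot e v + dot z v = norm2 z ^+ 2 - norm2 e ^+ 2.
  by rewrite vE !dotBr !dotxx [dot e z]dotC; ring.
(* The coefficient [(1 + 2 rho) L] collects [L |z|^2] from [zd2] and [2 rho L |z|^2] from
   [young]. *)
rewrite !dotDr /alpha2 mulNr a1E; lra.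
Qed.

(** Equal gains on position and velocity make the input deviation a multiple of [z = e + v], so
    monotonicity in the input damps exactly the second variable of the Lyapunov function. *)
Lemma control_law_sub {R : realType} {n : nat} (k : R)
    (ubar : 'cV[R]_n -> 'cV[R]_n -> 'cV[R]_n) (x : 'cV[R]_(n + n + (n + n))) :
  control_law k ubar x - ubar (nom_e x) (nom_v x) = - k *: (dev_e x + dev_v x).
Proof.
rewrite /control_law /kappa /real_e /real_v addrC addKr.
rewrite ![nom_e x + _]addrC ![nom_v x + _]addrC !addrK.
by rewrite -opprD -scalerDr scaleNr.
Qed.

Lemma alpha_gt0 {R : realType} (L rho k J : R) : 0 <= L -> L / 2 < rho ->
  0 < J -> J^-1 * ((1 + 2 * rho) * L + 5 / 4) < k ->
  [/\ 0 < rho, 0 < alpha1 L rho & 0 < alpha2 L rho k J].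
Proof.
move=> L0 Lrho J0 hk.
have rho0 : 0 < rho by lra.
split=> //.
  by rewrite /alpha1 subr_gt0 ltr_pdivrMr; lra.
by move: hk; rewrite mulrC ltr_pdivrMr// /alpha2; lra.
Qed.

(** * Robust invariance of the two deviation sets *)

Theorem lemma2 (R : realType) (n : nat)
    (W V U : set 'cV[R]_n)
    (hVconn : connected V) (hV0 : V 0)
    (hUconv : convex_set U) (hU0 : U 0)
    (dtil : R) (hdtil : 0 < dtil)
    (f : 'cV[R]_n -> 'cV[R]_n -> 'cV[R]_n -> 'cV[R]_n)
    (hfcont : continuous (uncurry3 f))
    (hfC1 : C1_on f W V U) (hf0 : f 0 0 0 = 0)
    (hfdiff0 : differentiable (uncurry3 f) (0, 0, 0))
    (hstab : stabilizable (lin_A f) (lin_B f))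
    (J_ : R) (hJ_ : 0 < J_)
    (hJ : forall chi v u, W chi -> V v -> U u ->
        J_ <= lambda_min (sym_part (jac_u f chi v u)))
    (hJsign : forall chi v u, W chi -> V v -> U u ->
        spectrum_nonneg (sym_part (jac_u f chi v u)))
    (L1 L2 L : R)
    (hL1 : lipschitz_chi f W V U L1) (hL2 : lipschitz_v f W V U L2)
    (hL : L = Num.max L1 L2)
    (chid : 'cV[R]_n)
    (ubar : 'cV[R]_n -> 'cV[R]_n -> 'cV[R]_n)
    (hubar : forall ebar vbar, W (ebar + chid) -> V vbar -> U (ubar ebar vbar))
    (rho k : R) (hrho : L / 2 < rho) (hk0 : 0 < k)
    (hk : J_^-1 * ((1 + 2 * rho) * L + 5 / 4) < k) :
  let a1 := alpha1 L rho in
  let a2 := alpha2 L rho k J_ in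
  let S := deviation_system f W V U dtil chid ubar in
  let law := control_law k ubar in
  [/\ 0 < a1, 0 < a2,
      renders_rci S law (state_set S `&` [set x | Omega1 dtil a1 a2 (dev_e x)]) &
      renders_rci S law (state_set S `&` [set x | Omega2 dtil a1 a2 (dev_v x)])].
Proof.
have [L1_ge0 f_chi] := hL1; have [L2_ge0 f_v] := hL2.
have L1L : L1 <= L by rewrite hL le_max lexx.
have L2L : L2 <= L by rewrite hL le_max lexx orbT.
have L0 : 0 <= L by exact: le_trans L1L.
have [rho0 a1_gt0 a2_gt0] := alpha_gt0 L rho k J_ L0 hrho hJ_ hk.
move=> a1 a2 S law; pose m := Num.min a1 a2.
have m0 : 0 < m by rewrite lt_min a1_gt0.
have decay (x : 'cV[R]_(n + n + (n + n))) d : state_set S x -> U (law x) ->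
    norm2 d <= dtil ->
    let y := col_mx (dev_e x) (dev_e x + dev_v x) in
    let w := usubmx (dyn S x (law x) d) in
    dtil ^+ 2 / m <= norm2 y ^+ 2 ->
    dot y (col_mx (usubmx w) (usubmx w + dsubmx w)) <= 0.
  move=> [Wx Vx Wn Vn] Ul dd y w; rewrite ler_pdivrMr// => my.
  have Ub := hubar _ _ Wn Vn.
  rewrite /y /w /S /= !col_mxKu col_mxKd dot_col_mx.
  set e := dev_e x; set v := dev_v x; set ub := ubar _ _ in Ub *.
  set fx := f _ _ _; set fn := f _ _ _.
  (* Position changes first, then velocity, then input. Each intermediate point combines admissible
     components of the real and nominal states, so it stays in [W x V x U]. *)
  pose f1 := f (nom_e x + chid) (real_v x) (law x).
  pose f2 := f (nom_e x + chid) (nom_v x) (law x).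
  have -> : fx - fn + d = (fx - f1) + (f1 - f2) + (f2 - fn) + d.
    by congr (_ + d); rewrite !addrA !subrK.
  have eE : real_e x + chid - (nom_e x + chid) = e.
    by rewrite /real_e opprD addrACA subrr addr0 addrC addKr.
  have vE : real_v x - nom_v x = v by rewrite /real_v addrC addKr.
  apply: le_trans
    (@lyapunov_decay _ _ e v _ _ _ d L rho k J_ dtil rho0 L0 hk0 _ _ dd _) _.
  - apply: (le_trans (f_chi _ _ _ _ Wx Wn Vx Ul)).
    by rewrite eE ler_wpM2r// norm2_ge0.
  - apply: (le_trans (f_v _ _ _ _ Wn Vx Vn Ul)).
    by rewrite vE ler_wpM2r// norm2_ge0.
  - rewrite -(control_law_sub k ubar x).
    apply: (@strongly_monotone_u _ _ U) => //.
    + by move=> u Uu; have [+ _ _ _] := hfC1; apply.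
    + by move=> u Uu; exact: hJ.
    + by move=> u Uu; exact: hJsign.
  (* Both rates are at least [m], so the dissipation is at least [m |y|^2], which dominates [dtil^2]
     by [my]. *)
  have m1 : m <= a1 by rewrite ge_min lexx.
  have m2 : m <= a2 by rewrite ge_min lexx orbT.
  move: my; rewrite /y norm2_col_mx -/e -/v => my.
  have := ler_wpM2r (sqr_ge0 (norm2 e)) m1.
  have := ler_wpM2r (sqr_ge0 (norm2 (e + v))) m2.
  by rewrite /a1 /a2; lra.
pose r := dtil / Num.sqrt m.
have r0 : 0 <= r by rewrite divr_ge0 ?sqrtr_ge0// ltW.
have rE : r ^+ 2 = dtil ^+ 2 / m by rewrite expr_div_n sqr_sqrtr// ltW.
have bound d x : (forall t, 0 <= t -> dist_set S (d t)) ->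
    closed_loop_solution S law d x ->
    forall t, 0 <= t ->
    norm2 (dev_e (x t)) <= r /\ norm2 (dev_e (x t) + dev_v (x t)) <= r.
  move=> dD [[e0 v0] xS xU xg] t t0.
  have wv := has_velocity_usubmx _ _ xg.
  have ev := has_velocity_usubmx _ _ wv; have vv := has_velocity_dsubmx _ _ wv.
  have := bounded_of_decay _ _ (dtil ^+ 2 / m)
    (has_velocity_col_mx _ _ _ _ ev (has_velocityD _ _ _ _ ev vv)).
  move=> H.
  have : norm2 (col_mx (dev_e (x t)) (dev_e (x t) + dev_v (x t))) ^+ 2
      <= r ^+ 2.
    rewrite rE.
    apply: H => //.
    (* The deviations start at 0, so the stacked vector starts at the centre of the ball. *)
    - rewrite -/(dev_e (x 0)) -/(dev_v (x 0)) e0 v0 addr0 col_mx0.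
      rewrite -dotxx /dot big1 => [|i _]; last by rewrite mxE mul0r.
      by rewrite divr_ge0 ?sqr_ge0// ltW.
    - by move=> s s0; apply: decay; [exact: xS|exact: xU|exact: dD].
  rewrite norm2_col_mx => nr.
  have ne := sqr_ge0 (norm2 (dev_e (x t))).
  have nz := sqr_ge0 (norm2 (dev_e (x t) + dev_v (x t))).
  split; rewrite -(ler_pXn2r (n := 2))// ?nnegrE ?norm2_ge0//; lra.
split=> //; split; try by move=> x [].
  move=> d x dD sol _ t t0; split; first by have [_ + _ _] := sol; apply.
  exact: (bound d x dD sol t t0).1.
move=> d x dD sol _ t t0; split; first by have [_ + _ _] := sol; apply.
have [er zr] := bound d x dD sol t t0.
(* As a difference of two vectors of norm at most [r], the velocity deviation acquires the factor 2
   of [Omega2]. *)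
have vE : dev_v (x t) = dev_e (x t) + dev_v (x t) - dev_e (x t).
  by rewrite addrC addKr.
rewrite /Omega2 /= vE (le_trans (norm2B_le _ _))// -mulrA -/m -/r; lra.
Qed.
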